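(* Let $s\ge1$ be an integer, let $\alpha$ be a positive integer or $\alpha=\infty$, and for $m,\xi,n>0$ let $$U=U(m,\xi,n)=m^{-2(\xi\wedge\alpha)/s}+\frac{m\,\xi^s}{n}.$$ Then the following statements are true. I. Fixing the product $m\xi^s=C$ (with $C>0$), $U$ is minimized at $\xi=\alpha\wedge(C^{1/s}/e)\equiv\xi_o$. The corresponding optimal $m$ is $m=\max(e^s,C/\alpha^s)$. II. If $\alpha$ is finite, then $U$ achieves the rate $n^{-2\alpha/(s+2\alpha)}$, i.e. $U=O(n^{-2\alpha/(s+2\alpha)})$ as $n\to\infty$, under the following choices: $\xi$ is any constant that is at least $\alpha$ and does not vary with $n$, and $m\approx c_1n^{s/(s+2\alpha)}$ for any constant $c_1>0$. III. If $\alpha=\infty$, then $U=O((\ln n)^s/n)$ as $n\to\infty$ under the following choices: $m\ge2$ is constant in $n$, and $\xi\approx c_2\ln n$ for any constant $c_2\ge s$.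
   Context: $x\wedge y=\min(x,y)$, and $C/\alpha^s=0$ when $\alpha=\infty$. In the paper $\xi=k+1$, where $k$ is the degree of polynomial experts, $m$ is the number of experts, $s$ the input dimension, $n$ the sample size and $\alpha$ the smoothness of the target; in the optimization in part I, $m$ and $\xi$ are treated as positive real variables. The notation $u_n\approx v_n$ means $u_n/v_n\to1$ as $n\to\infty$. *)

(* Defs.v *)
From HB Require Import structures.
From mathcomp Require Import all_boot all_order all_algebra.
From mathcomp Require Import all_classical all_reals all_analysis.

Set Implicit Arguments.
Unset Strict Implicit.
Unset Printing Implicit Defensive.

Import Order.TTheory GRing.Theory Num.Theory.
Import numFieldNormedType.Exports.

Local Open Scope classical_set_scope.
Local Open Scope ring_scope.

(* The smoothness alpha ranges over {1, 2, ...} together with infinity: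
   [Some a] is the integer [a] and [None] is infinity. *)
Definition smoothness_pos (alpha : option nat) : Prop :=
  if alpha is Some a then (0 < a)%N else True.

(* min(x, alpha), equal to x when alpha is infinite. *)
Definition min_smooth (R : realType) (x : R) (alpha : option nat) : R :=
  if alpha is Some a then Num.min x a%:R else x.

(* C / alpha ^ s, equal to 0 when alpha is infinite. *)
Definition div_smooth (R : realType) (C : R) (s : nat) (alpha : option nat) : R :=
  if alpha is Some a then C / a%:R ^+ s else 0.

Definition U (R : realType) (s : nat) (alpha : option nat) (m xi n : R) : R :=
  m `^ (- (2 * min_smooth xi alpha / s%:R)) + m * xi ^+ s / n.

Definition feasible (R : realType) (s : nat) (C m xi : R) : Prop :=
  [/\ 0 < m, 0 < xi & m * xi ^+ s = C].

Definition minimizer (R : realType) (s : nat) (alpha : option nat)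
    (C n m xi : R) : Prop :=
  feasible s C m xi /\
  forall m' xi' : R, feasible s C m' xi' -> U s alpha m xi n <= U s alpha m' xi' n.

Definition xi_opt (R : realType) (s : nat) (alpha : option nat) (C : R) : R :=
  min_smooth (C `^ s%:R^-1 / expR 1) alpha.

Definition m_opt (R : realType) (s : nat) (alpha : option nat) (C : R) : R :=
  Num.max (expR 1 ^+ s) (div_smooth C s alpha).

Definition asymp_equiv (R : realType) (u v : nat -> R) : Prop :=
  (fun n => u n / v n) @ \oo --> (1 : R).

(* Main.v *)
(* Part I: on the curve [m * xi ^ s = C], minimizing [U] amounts to maximizing
   [min(xi, alpha) * ln m], where [ln m = s * (1 + ln (x0 / xi))] and
   [x0 = C ^ (1 / s) / e]. The strict inequality [ln x < x - 1] for [x != 1]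
   shows that the maximizer is unique and equal to [min(x0, alpha)].
   Parts II and III: sandwiching [m], resp. [xi], between constant multiples of
   its equivalent bounds both terms of [U] by the claimed rate. *)
Require Import Defs.
From HB Require Import structures.
From mathcomp Require Import all_boot all_order all_algebra.
From mathcomp Require Import all_classical all_reals all_analysis.
From mathcomp Require Import ring lra.

Set Implicit Arguments.
Unset Strict Implicit.
Unset Printing Implicit Defensive.

Import Order.TTheory GRing.Theory Num.Theory.
Import numFieldNormedType.Exports.

Local Open Scope classical_set_scope.
Local Open Scope ring_scope.

(** * Elementary bounds on logarithms and powers *)

Lemma ln_lt_subr1 (R : realType) (x : R) : 0 < x -> x != 1 -> ln x < x - 1.
Proof.
move=> x0 x1; rewrite ltrBrDl -[ltRHS]lnK ?posrE//.
by apply: expR_gt1Dx; rewrite ln_eq0.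
Qed.

Lemma powR_expR (R : realType) (x r : R) : 0 < x -> x `^ r = expR (r * ln x).
Proof. by move=> x0; rewrite /powR gt_eqF. Qed.

Lemma powRN_le (R : realType) (x y r : R) :
  0 <= r -> 0 < x -> x <= y -> y `^ (- r) <= x `^ (- r).
Proof.
move=> r0 x0 xy; have y0 := lt_le_trans x0 xy.
by rewrite !powR_expR// ler_expR !mulNr lerN2 ler_wpM2l// ler_ln.
Qed.

(** * Optimization on the curve [m * xi ^ s = C] *)

Lemma min_smooth_gt0 (R : realType) (x : R) (alpha : option nat) :
  smoothness_pos alpha -> 0 < x -> 0 < min_smooth x alpha.
Proof. by case: alpha => //= a a0 x0; rewrite lt_min x0 ltr0n. Qed.

(** With [x0 = C ^ (1 / s) / e], this is minus half the logarithm of the first term of [U] on the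
    curve. *)
Definition gain (R : realType) (alpha : option nat) (x0 xi : R) : R :=
  min_smooth xi alpha * (1 + ln (x0 / xi)).

Lemma gain_lt (R : realType) (alpha : option nat) (x0 xi : R) :
  smoothness_pos alpha -> 0 < x0 -> 0 < xi -> xi != min_smooth x0 alpha ->
  gain alpha x0 xi < gain alpha x0 (min_smooth x0 alpha).
Proof.
move=> ha x00 xi0; set o := min_smooth x0 alpha => xio.
have o0 : 0 < o by exact: min_smooth_gt0.
have ratio_neq1 : o / xi != 1.
  by apply: contra_neq xio => h; rewrite -[LHS]mul1r -h divfK ?gt_eqF.
(* This is [ln x < x - 1] at [x = o / xi], multiplied by [xi]. *)
have xil : xi * ln (o / xi) < o - xi.
  have -> : o - xi = xi * (o / xi - 1) by field; rewrite gt_eqF.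
  by rewrite ltr_pM2l// ln_lt_subr1// divr_gt0.
have -> : gain alpha x0 o = o * (1 + ln (x0 / o)).
  by rewrite /gain /o; case: (alpha) => //= a; rewrite -minA minxx.
have ln_split : ln (x0 / xi) = ln (x0 / o) + ln (o / xi).
  rewrite -lnM ?posrE ?divr_gt0//; congr ln; field.
  by rewrite !gt_eqF.
rewrite /gain ln_split; set l := ln (o / xi) in xil *; set k := ln (x0 / o).
(* Either the cap is active, with [o = a < x0], or [o] is the unconstrained optimum [x0]. *)
have [ox0|ox0] : (o < x0 /\ exists2 a, alpha = Some a & o = a%:R) \/ o = x0.
- rewrite /o; case: (alpha) => [a|] /=; last by right.
  by have [_|ax] := leP x0 a%:R; [right | left; split => //; exists a].
- case: ox0 => ox0 [a aE oE]; rewrite aE /=.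
  have k0 : 0 < k by rewrite ln_gt0// ltr_pdivlMr// mul1r.
  rewrite -oE; case: (leP xi o) => xo.
    by nra.
  (* Beyond the cap the first factor stays at [o] while the logarithm decreases. *)
  have l0 : l < 0 by rewrite ln_lt0// divr_gt0//= ltr_pdivrMr// mul1r.
  by nra.
- have -> : k = 0 by rewrite /k -ox0 divff ?gt_eqF// ln1.
  rewrite addr0 addrA addr0 mulr1.
  have t0 := min_smooth_gt0 ha xi0.
  have : min_smooth xi alpha <= xi.
    by case: (alpha) => //= a; rewrite ge_min lexx.
  set t := min_smooth xi alpha in t0 * => txi.
  (* If [1 + l >= 0], then [t * (1 + l) <= xi * (1 + l) < o] by [xil]; otherwise the left side is
     negative. *)
  by case: (leP 0 (1 + l)) => hl; nra.
Qed.

Lemma feasible_opt (R : realType) (s : nat) (alpha : option nat) (C : R) :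
  (0 < s)%N -> smoothness_pos alpha -> 0 < C ->
  feasible s C (m_opt s alpha C) (xi_opt s alpha C).
Proof.
move=> s0 ha C0; rewrite /feasible /xi_opt.
have CE : C = (expR 1 * (C `^ s%:R^-1 / expR 1)) ^+ s.
  rewrite mulrC divfK ?gt_eqF ?expR_gt0// -powR_mulrn ?powR_ge0//.
  by rewrite -powRrM mulVf ?pnatr_eq0 -?lt0n// powRr1// ltW.
have x00 : 0 < C `^ s%:R^-1 / expR 1 by rewrite divr_gt0 ?powR_gt0 ?expR_gt0.
move: (_ / expR 1) CE x00 => x0 CE x00.
have es0 : (0 : R) < expR 1 ^+ s by rewrite exprn_gt0 ?expR_gt0.
split; [by rewrite /m_opt lt_max es0 | exact: min_smooth_gt0 |].
rewrite /m_opt; case: alpha ha => [a a0|_] /=; last first.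
  by rewrite (max_l (ltW es0)) [RHS]CE exprMn.
have a0R : (0 : R) < a%:R by rewrite ltr0n.
(* Since [C = (e * x0) ^ s], the maximum is [e ^ s * max(1, (x0 / a) ^ s)], and comparing [x0] with
   [a] decides it. *)
rewrite {1}CE exprMn -mulrA -expr_div_n -{1}[expR 1 ^+ s]mulr1.
rewrite -maxr_pMr ?ltW//; case: (leP x0 a%:R) => xa.
  rewrite (max_l (_ : _ <= 1)).
    by rewrite mulr1 [RHS]CE exprMn.
  by rewrite exprn_ile1 ?ler_pdivrMr ?mul1r// divr_ge0 ?ltW.
rewrite (max_r (_ : 1 <= _)).
  by rewrite -mulrA -exprMn divfK ?gt_eqF// [RHS]CE exprMn.
by rewrite exprn_ege1// ler_pdivlMr// mul1r ltW.
Qed.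

(** The second term of [U] is constant on the curve, so only [gain] matters for the comparison. *)
Lemma U_feasible (R : realType) (s : nat) (alpha : option nat) (C n m xi : R) :
  (0 < s)%N -> feasible s C m xi ->
  U s alpha m xi n =
  expR (- (2 * gain alpha (C `^ s%:R^-1 / expR 1) xi)) + C / n.
Proof.
move=> s0 [m0 xi0 <-]; rewrite /U /gain; congr (_ + _).
have s0R : s%:R != 0 :> R by rewrite pnatr_eq0 -lt0n.
have xs0 : 0 < xi ^+ s by rewrite exprn_gt0.
rewrite powR_expR//; congr expR.
rewrite ln_div ?posrE ?divr_gt0 ?powR_gt0 ?expR_gt0 ?mulr_gt0//.
rewrite ln_div ?posrE ?powR_gt0 ?expR_gt0 ?mulr_gt0//.
rewrite ln_powR expRK lnM ?posrE// lnXn// -mulr_natr.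
by field.
Qed.

Lemma minimizerP (R : realType) (s : nat) (alpha : option nat) (C n m xi : R) :
  (0 < s)%N -> smoothness_pos alpha -> 0 < C ->
  minimizer s alpha C n m xi <->
  xi = xi_opt s alpha C /\ m = m_opt s alpha C.
Proof.
move=> s0 ha C0; have fo := feasible_opt s0 ha C0.
have x00 : 0 < C `^ s%:R^-1 / expR 1 by rewrite divr_gt0 ?powR_gt0 ?expR_gt0.
split=> [[fm /(_ _ _ fo)]|[-> ->]]; last first.
  split=> // m' xi' fm'; rewrite (U_feasible _ _ s0 fo) (U_feasible _ _ s0 fm').
  rewrite lerD2r ler_expR lerN2 ler_pM2l//.
  have [->//|ne] := eqVneq xi' (xi_opt s alpha C).
  by case: fm' => _ xi0 _; exact/ltW/gain_lt.
rewrite (U_feasible _ _ s0 fm) (U_feasible _ _ s0 fo).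
rewrite lerD2r ler_expR lerN2 ler_pM2l// => le_gain.
have xiE : xi = xi_opt s alpha C.
  apply/eqP; apply: contraTT le_gain => ne; rewrite -ltNge.
  by case: fm => _ xi0 _; exact: gain_lt.
(* Once [xi] is known, the constraint determines [m]. *)
split=> //; case: fo => _ o0 oE; case: fm => _ _; rewrite xiE -{2}oE.
by apply/mulIf; rewrite expf_neq0// gt_eqF.
Qed.

(** * Rates of convergence under asymptotic equivalence *)

Lemma asymp_equiv_bounds (R : realType) (u v : nat -> R) (e : R) :
  asymp_equiv u v -> (\forall n \near \oo, 0 < v n) -> 0 < e ->
  \forall n \near \oo, (1 - e) * v n <= u n <= (1 + e) * v n.
Proof.
move=> uv v0 e0; near=> n; have vn : 0 < v n by near: n.
apply/andP; split; [rewrite -ler_pdivlMr// | rewrite -ler_pdivrMr//]; near: n.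
- by apply: (cvgr_ge _ uv); rewrite ltrBlDr ltrDl.
- by apply: (cvgr_le _ uv); rewrite ltrDl.
Unshelve. all: by end_near. Qed.

Lemma eqO_of_le (R : realType) (f g : nat -> R) (k : R) :
  0 < k -> (\forall n \near \oo, 0 <= f n <= k * g n) ->
  f =O_\oo g.
Proof.
move=> k0 fg; apply/eqO_exP; exists k => //; apply: filterS fg => n.
move=> /andP[f0 fk]; rewrite !ger0_norm//.
by rewrite -(pmulr_rge0 _ k0) (le_trans f0).
Qed.

Lemma U_ge0 (R : realType) (s : nat) (alpha : option nat) (m xi n : R) :
  0 <= m -> 0 <= xi -> 0 <= n -> 0 <= U s alpha m xi n.
Proof.
by move=> *; rewrite addr_ge0 ?powR_ge0// divr_ge0// mulr_ge0// exprn_ge0.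
Qed.

Lemma U_rate_finite (R : realType) (s a : nat) (xi c1 : R) (m : nat -> R) :
  (0 < s)%N -> (0 < a)%N -> a%:R <= xi -> 0 < c1 ->
  asymp_equiv m (fun n => c1 * n%:R `^ (s%:R / (s%:R + 2 * a%:R))) ->
  (fun n : nat => U s (Some a) (m n) xi n%:R) =O_\oo
  (fun n : nat => n%:R `^ (- (2 * a%:R / (s%:R + 2 * a%:R)))).
Proof.
move=> s0 a0 axi c0 mE.
have s0R : (0 : R) < s%:R by rewrite ltr0n.
have a0R : (0 : R) < a%:R by rewrite ltr0n.
have xi0 : 0 < xi by exact: lt_le_trans axi.
have d0 : (0 : R) < s%:R + 2 * a%:R by rewrite addr_gt0// mulr_gt0.
pose q : R := 2 * a%:R / s%:R.
have q0 : 0 <= q by rewrite divr_ge0 ?mulr_ge0 ?ltW.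
have e0 : (0 : R) < 2^-1 by rewrite invr_gt0.
have c20 : 0 < c1 / 2 by rewrite divr_gt0.
have v0 : \forall n \near \oo,
    0 < c1 * (n%:R : R) `^ (s%:R / (s%:R + 2 * a%:R)).
  by near do rewrite mulr_gt0// powR_gt0// ltr0n.
(* Each summand bounds one term of [U]; the lower bound on [m] serves the first, the upper bound the
   second. *)
apply: (@eqO_of_le _ _ _ ((c1 / 2) `^ (- q) + 2 * c1 * xi ^+ s)).
  by rewrite addr_gt0 ?powR_gt0// ?mulr_gt0// exprn_gt0.
near=> n.
have n0 : (0 : R) < n%:R by rewrite ltr0n; near: n; exact: nbhs_infty_gt.
set p : R := s%:R / (s%:R + 2 * a%:R).
have np0 : 0 < n%:R `^ p by exact: powR_gt0.
have /andP[ml mu] : c1 / 2 * n%:R `^ p <= m n <= 2 * c1 * n%:R `^ p.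
  have : (1 - 2^-1) * (c1 * n%:R `^ p) <= m n <= (1 + 2^-1) * (c1 * n%:R `^ p).
    by near: n; exact: (asymp_equiv_bounds mE v0 e0).
  have cn0 : 0 < c1 * n%:R `^ p by exact: mulr_gt0.
  by move=> /andP[? ?]; apply/andP; split; lra.
have m0 : 0 < m n by rewrite (lt_le_trans _ ml)// mulr_gt0.
rewrite (U_ge0 _ _ (ltW m0) (ltW xi0) (ltW n0))/= /U /= (min_r axi).
rewrite [leRHS]mulrDl lerD//.
  apply: (le_trans (powRN_le q0 _ ml)); first by rewrite mulr_gt0.
  rewrite (powRM _ (ltW c20) (ltW np0)) -powRrM.
  suff -> : p * - q = - (2 * a%:R / (s%:R + 2 * a%:R)) by [].
  by rewrite /p /q; field; rewrite !gt_eqF.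
(* The exponent [p] balances the two terms: [- p * q = p - 1]. *)
have -> : - (2 * a%:R / (s%:R + 2 * a%:R)) = p - 1.
  by rewrite /p; field; rewrite gt_eqF.
rewrite powRB; last by rewrite (gt_eqF n0) implybT.
rewrite (powRr1 (ltW n0)) mulrA ler_pM2r ?invr_gt0//.
by rewrite mulrAC ler_pM2r// exprn_gt0.
Unshelve. all: by end_near. Qed.

(** From [exp(-2/7) >= 5/7], squaring gives [exp(-4/7) >= 25/49 >= 1/2]. *)
Lemma ln2_ge (R : realType) : 4 / 7 <= ln 2 :> R.
Proof.
rewrite -ler_expR lnK ?posrE//.
have h : 5 / 7 <= expR (- (2 / 7)) :> R.
  by apply: le_trans (expR_ge1Dx _); lra.
have -> : 4 / 7 = - (- (2 / 7) + - (2 / 7)) :> R by lra.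
rewrite expRN expRD invf_ple ?posrE ?mulr_gt0 ?expR_gt0//.
by nra.
Qed.

Lemma U_rate_infinite (R : realType) (s : nat) (m c2 : R) (xi : nat -> R) :
  (0 < s)%N -> 2 <= m -> s%:R <= c2 ->
  asymp_equiv xi (fun n => c2 * ln n%:R) ->
  (fun n : nat => U s None m (xi n) n%:R) =O_\oo
  (fun n : nat => ln n%:R ^+ s / n%:R).
Proof.
move=> s0 m2 sc xiE.
have s0R : (0 : R) < s%:R by rewrite ltr0n.
have c0 : 0 < c2 by exact: lt_le_trans sc.
have m0 : 0 < m by exact: lt_le_trans m2.
have ln_ge1 : \forall n \near \oo, 1 <= ln (n%:R : R).
  near=> n; rewrite -[leLHS]expRK ler_ln ?posrE ?expR_gt0//.
  - by near: n; exact: nbhs_infty_ger.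
  - by rewrite ltr0n; near: n; exact: nbhs_infty_gt.
have v0 : \forall n \near \oo, 0 < c2 * ln (n%:R : R).
  by apply: filterS ln_ge1 => n n1; rewrite mulr_gt0// (lt_le_trans _ n1).
(* [7 / 8 * 2 * ln 2 >= 1] by [ln2_ge], so a relative error of [1 / 8] in [xi]
   still gives [m ^ (- 2 * xi / s) <= 1 / n]. *)
have e0 : (0 : R) < 8^-1 by rewrite invr_gt0.
apply: (@eqO_of_le _ _ _ (1 + m * (2 * c2) ^+ s)).
  by rewrite addr_gt0// mulr_gt0// exprn_gt0// mulr_gt0.
near=> n.
have n0 : (0 : R) < n%:R by rewrite ltr0n; near: n; exact: nbhs_infty_gt.
have L1 : 1 <= ln (n%:R : R) by near: n.
have cL0 : 0 < c2 * ln (n%:R : R) by near: n.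
have /andP[xl xu] : (1 - 8^-1) * (c2 * ln (n%:R : R)) <= xi n <=
    (1 + 8^-1) * (c2 * ln (n%:R : R)).
  by near: n; exact: (asymp_equiv_bounds xiE v0 e0).
have xi0 : 0 < xi n by apply: lt_le_trans xl; rewrite mulr_gt0//; lra.
rewrite (U_ge0 _ _ (ltW m0) (ltW xi0) (ltW n0))/= /U /=.
rewrite [leRHS]mulrDl mul1r lerD//.
  have lnm : 4 / 7 <= ln m.
    by apply: (le_trans (@ln2_ge R)); rewrite ler_ln ?posrE.
  (* The first term is at most [1 / n], which is within the rate because [ln n >= 1]. *)
  apply: (@le_trans _ _ n%:R^-1); last first.
    by rewrite -[leLHS]mul1r ler_pM2r ?invr_gt0// exprn_ege1.
  rewrite powR_expR// -[X in _ <= X^-1]lnK ?posrE// -expRN ler_expR.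
  rewrite mulNr lerN2 -mulrAC ler_pdivlMr// mulrC.
  (* Here [c2 >= s] enters: [2 * xi * ln m >= 2 * (7/8) * (4/7) * c2 * ln n = c2 * ln n >= s * ln
     n]. *)
  have lt1 : s%:R * ln n%:R <= c2 * ln (n%:R : R).
    by rewrite ler_pM2r// (lt_le_trans _ L1).
  by nra.
rewrite mulrA ler_pM2r ?invr_gt0// -mulrA ler_pM2l// -exprMn.
have xu2 : xi n <= 2 * c2 * ln n%:R by rewrite -mulrA; lra.
by rewrite lerXn2r// nnegrE ltW// (lt_le_trans xi0).
Unshelve. all: by end_near. Qed.

Theorem proposition4p1 (R : realType) (s : nat) (alpha : option nat)
    (hs : (1 <= s)%N) (halpha : smoothness_pos alpha) :
  [/\ forall C n : R, 0 < C -> 0 < n ->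
        forall m xi : R,
          minimizer s alpha C n m xi <->
          xi = xi_opt s alpha C /\ m = m_opt s alpha C,
      forall a : nat, alpha = Some a ->
        forall (xi c1 : R) (m : nat -> R),
          a%:R <= xi -> 0 < c1 ->
          (forall n : nat, (0 < n)%N -> 0 < m n) ->
          asymp_equiv m
            (fun n => c1 * n%:R `^ (s%:R / (s%:R + 2 * a%:R))) ->
          (fun n : nat => U s alpha (m n) xi n%:R) =O_\oo
          (fun n : nat => n%:R `^ (- (2 * a%:R / (s%:R + 2 * a%:R))))
    & alpha = None ->
        forall (m c2 : R) (xi : nat -> R),
          2 <= m -> s%:R <= c2 ->
          (forall n : nat, (0 < n)%N -> 0 < xi n) ->
          asymp_equiv xi (fun n => c2 * ln n%:R) ->
          (fun n : nat => U s alpha m (xi n) n%:R) =O_\oo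
          (fun n : nat => ln n%:R ^+ s / n%:R)].
Proof.
split.
- by move=> C n C0 _ m xi; exact: minimizerP.
- move=> a alphaE xi c1 m axi c0 _; rewrite alphaE in halpha *.
  exact: U_rate_finite.
- by move=> -> m c2 xi m2 sc _; exact: U_rate_infinite.
Qed.
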